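(* Suppose that $\omega:\mathbb R^n\to\mathbb R$ is convex, that all its level sets $\mathrm{Lev}_\omega(\alpha)$, $\alpha\in\mathbb R$, are compact, and that there are $\gamma>0$, $\kappa\in(0,2]$ with $\operatorname{dist}(\mathbf x,\mathrm{Lev}_\omega(\alpha))^\kappa\le\gamma[\omega(\mathbf x)-\alpha]_+$ for all $\mathbf x\in\mathbb R^n$ and all $\alpha\ge\underline\omega$. Run ITALEX-CT with any approximation oracle and with the expansion oracle $\mathcal E^{\omega,\varphi}(\alpha,\bar\varphi,\rho)=\alpha+\frac{\rho^{\kappa/2}}{\gamma}$. For any $\varepsilon>0$, after $R\le\lceil\log_2(\epsilon_1/\varepsilon)\rceil+1$ iterations of ITALEX-CT, requiring a total number $N$ of calls to the approximation oracle, where $$N\le\frac{2^\kappa\gamma(\omega^*-\omega(\mathbf z^0))}{\varepsilon^{\kappa/2}}+R,$$ we obtain a solution $\mathbf x^R$ such that $$\varphi(\mathbf x^R)-\varphi^*\le\varepsilon,\qquad\operatorname{dist}(\mathbf x^R,\mathrm{Lev}_\omega(\omega^* ))\le\sqrt\varepsilon,$$ and additionally $$\omega(\mathbf x^R)-\omega^*\le\ell_{\omega,R_0}\sqrt\varepsilon,$$ where $\bar\omega$ is an upper bound on $\omega^*$ and $\ell_{\omega,R_0}$ is the finite Lipschitz constant of $\omega$ over the compact set $$\mathcal W^0=\left\{\mathbf x\in\mathbb R^n:\operatorname{dist}(\mathbf x,\mathrm{Lev}_\omega(\alpha_0))\le R_0\right\},\qquad R_0\equiv(\gamma(\bar\omega-\omega(\mathbf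 z^0)))^{1/\kappa}+\sqrt\varepsilon .$$
   Context: Setup. $\varphi=f+g$, where $f:\mathbb R^n\to\mathbb R$ is convex and continuously differentiable with $L_f$-Lipschitz gradient and $g:\mathbb R^n\to\mathbb R\cup\{\infty\}$ is proper, closed and convex. $\varphi^*=\min_{\mathbb R^n}\varphi$ and $X^*=\arg\min\varphi$ is nonempty. $\omega^*=\min_{\mathbf x\in X^*}\omega(\mathbf x)$; $\underline\omega=\inf_{\mathbb R^n}\omega$. $\mathrm{Lev}_\omega(\alpha)=\{\mathbf x:\omega(\mathbf x)\le\alpha\}$; $[r]_+=\max\{r,0\}$; $\|\cdot\|$ is the Euclidean norm and $\operatorname{dist}$ the Euclidean distance. Define $$h(\alpha)=\min_{\mathbf x,\mathbf z\in\mathbb R^n}\{\varphi(\mathbf x)+\|\mathbf x-\mathbf z\|^2:\ \omega(\mathbf z)\le\alpha\}.$$ Approximation oracle. An operator $\mathcal O^{\omega,\varphi}(\mathbf x,\mathbf z,\alpha,\bar\varphi,\varepsilon)$ is an approximation oracle if for any $\varepsilon>0$, $\bar\varphi\ge\varphi^*$, $\alpha\ge\underline\omega$, $\mathbf x\in\mathrm{dom}(\varphi)$, $\mathbf z\in\mathrm{Lev}_\omega(\alpha)$ it returns a triple $(\rho,\mathbf y_1,\mathbf y_2)\in\mathbb R_+\times\mathrm{dom}(g)\times\mathrm{Lev}_\omega(\alpha)$ such that either $\rho\in[\frac{\varepsilon}{2},h(\alpha)-\bar\varphi]$, or [$\varphi(\mathbf y_1)+\|\mathbf y_1-\mathbf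 y_2\|^2\le\bar\varphi+\varepsilon$ and $\rho=0$]. ITALEX-FT. Input: $\varepsilon>0$, $\bar\varphi\ge\varphi^*$, oracles $\mathcal O^{\omega,\varphi},\mathcal E^{\omega,\varphi}$, $\tilde\alpha_0\le\omega^*$, $\tilde{\mathbf x}^0\in\mathrm{dom}(\varphi)$, $\tilde{\mathbf z}^0\in\mathrm{Lev}_\omega(\tilde\alpha_0)$. For $k=1,2,\dots$: set $(\rho_k,\tilde{\mathbf x}^k,\tilde{\mathbf z}^k)=\mathcal O^{\omega,\varphi}(\tilde{\mathbf x}^{k-1},\tilde{\mathbf z}^{k-1},\tilde\alpha_{k-1},\bar\varphi,\frac{\varepsilon}{2})$; if $\varphi(\tilde{\mathbf x}^k)+\|\tilde{\mathbf x}^k-\tilde{\mathbf z}^k\|^2\le\bar\varphi+\frac{\varepsilon}{2}$, terminate and return $\tilde\alpha_{k-1}$ and $(\tilde{\mathbf x}^k,\tilde{\mathbf z}^k)$; otherwise set $\tilde\alpha_k=\mathcal E^{\omega,\varphi}(\tilde\alpha_{k-1},\bar\varphi,\rho_k)$. ITALEX-CT. Input: $\epsilon_1>0$, $\alpha_0\le\omega^*$, $\mathbf x^0\in\mathrm{dom}(g)$, $\mathbf z^0\in\mathrm{Lev}_\omega(\alpha_0)$, $\mathbf u^0\in\mathrm{dom}(g)$, and an algorithm $\mathcal C$ that, given a starting point $\mathbf u$ and tolerance $\epsilon>0$, returns $\mathbf v=\mathcal C(\mathbf u,\epsilon)$ with $\varphi(\mathbf v)\le\varphi^*+\epsilon$.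 For $r=1,2,\dots$: compute $\mathbf u^r=\mathcal C(\mathbf u^{r-1},\frac{\epsilon_r}{2})$ and $\bar\varphi^r=\varphi(\mathbf u^r)$; if $\varphi(\mathbf x^{r-1})+\|\mathbf x^{r-1}-\mathbf z^{r-1}\|^2>\bar\varphi^r+\frac{\epsilon_r}{2}$, let $(\alpha_r,\mathbf x^r,\mathbf z^r)$ be the output of ITALEX-FT with $\varepsilon=\epsilon_r$, $\bar\varphi=\bar\varphi^r$, the same oracles, and starting data $(\tilde\alpha_0,\tilde{\mathbf x}^0,\tilde{\mathbf z}^0)=(\alpha_{r-1},\mathbf x^{r-1},\mathbf z^{r-1})$; otherwise set $(\alpha_r,\mathbf x^r,\mathbf z^r)=(\alpha_{r-1},\mathbf x^{r-1},\mathbf z^{r-1})$. Then set $\epsilon_{r+1}=\epsilon_r/2$.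
   Formalization: In the bound on N, ε is replaced by min(ε, ε_R), with ε_R = ε_1/2^(R-1) the last tolerance (the printed bound can fail when ε_R < ε), and R ≤ max(⌈log2(ε_1/ε)⌉+1, 1), since the printed bound on R is at most 0 for ε ≥ 2ε_1. *)

(* Defs.v *)
(* MathComp-Analysis, over an arbitrary R : realType. *)
From HB Require Import structures.
From mathcomp Require Import all_boot all_order all_algebra.
From mathcomp Require Import all_classical all_reals all_analysis.

Set Implicit Arguments.
Unset Strict Implicit.
Unset Printing Implicit Defensive.
Import Order.TTheory GRing.Theory Num.Theory.
Import numFieldNormedType.Exports.

Local Open Scope classical_set_scope.
Local Open Scope ring_scope.

Section Euclidean.
Context {R : realType} {n : nat}.
Implicit Types (x y : 'rV[R]_n) (A : set 'rV[R]_n).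

(* The library norm on 'rV[R]_n is the max norm, hence an explicit Euclidean
   norm; the topologies agree, so the library's compact, closed, continuous and
   differentiable are the usual notions. *)
Definition enorm x : R := Num.sqrt (\sum_i x ord0 i ^+ 2).

(* A real infimum: equal to 0 if A is empty. *)
Definition edistance x A : R := inf [set enorm (x - y) | y in A].

Definition gradient (f : 'rV[R]_n -> R) x : 'rV[R]_n :=
  \row_i 'D_(delta_mx ord0 i) f x.

(* The least Lipschitz constant on A for the Euclidean norm; +oo if none. *)
Definition lipschitz_const (w : 'rV[R]_n -> R) A : \bar R :=
  ereal_inf [set L%:E | L in [set L : R | 0 <= L /\
    forall x y, A x -> A y -> `|w x - w y| <= L * enorm (x - y)]].

End Euclidean.

Section Functions.
Context {R : realType} {n : nat}.
Implicit Types (f w : 'rV[R]_n -> R) (g phi : 'rV[R]_n -> \bar R).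

Definition level w (a : R) : set 'rV[R]_n := [set x | w x <= a].

Definition edom phi : set 'rV[R]_n := [set x | (phi x < +oo)%E].

Definition proper_function g : Prop := (forall x, g x != -oo%E) /\ edom g !=set0.

Definition closed_function g : Prop :=
  closed [set p : 'rV[R]_n * R | (g p.1 <= p.2%:E)%E].

(* In \bar R, 0 * +oo = 0, so t = 0 and t = 1 impose nothing. *)
Definition convex_efunction g : Prop :=
  forall (x y : 'rV[R]_n) (t : R), 0 <= t -> t <= 1 ->
    (g (t *: x + (1 - t) *: y)%R <= t%:E * g x + (1 - t)%:E * g y)%E.

Definition smooth_convex f (Lf : R) : Prop :=
  [/\ convex_function [set: 'rV[R]_n] f,
      forall x, differentiable f x,
      continuous (gradient f) &
      forall x y, enorm (gradient f x - gradient f y) <= Lf * enorm (x - y)].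

Definition minval phi : \bar R := ereal_inf (range phi).

Definition argmin phi : set 'rV[R]_n := [set x | forall y, (phi x <= phi y)%E].

Definition composite f g : 'rV[R]_n -> \bar R := fun x => ((f x)%:E + g x)%E.

Definition omega_star w phi : R := inf [set w x | x in argmin phi].

Definition omega_low w : \bar R := ereal_inf (range (fun x => (w x)%:E)).

Definition error_bound w (gamma kappa : R) : Prop :=
  forall (x : 'rV[R]_n) (a : R), (omega_low w <= a%:E)%E ->
    edistance x (level w a) `^ kappa <= gamma * Num.max (w x - a) 0.

Definition penalized phi (x z : 'rV[R]_n) : \bar R :=
  (phi x + (enorm (x - z) ^+ 2)%:E)%E.

Definition hfun w phi (a : R) : \bar R :=
  ereal_inf [set penalized phi p.1 p.2 |
    p in [set p : 'rV[R]_n * 'rV[R]_n | level w a p.2]].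

End Functions.

Section Algorithms.
Context {R : realType} {n : nat}.
Implicit Types (w : 'rV[R]_n -> R) (g phi : 'rV[R]_n -> \bar R).

(* orc x z alpha phibar eps = (rho, y1, y2) *)
Definition approx_op : Type :=
  'rV[R]_n -> 'rV[R]_n -> R -> R -> R -> R * 'rV[R]_n * 'rV[R]_n.

(* E alpha phibar rho = new alpha *)
Definition expansion_op : Type := R -> R -> R -> R.

Definition approximation_oracle w g phi (orc : approx_op) : Prop :=
  forall (x z : 'rV[R]_n) (alpha phibar eps : R),
    0 < eps -> (minval phi <= phibar%:E)%E -> (omega_low w <= alpha%:E)%E ->
    edom phi x -> level w alpha z ->
    forall (rho : R) (y1 y2 : 'rV[R]_n),
      orc x z alpha phibar eps = (rho, y1, y2) ->
      [/\ 0 <= rho, edom g y1, level w alpha y2 &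
          (eps / 2 <= rho /\ (rho%:E <= hfun w phi alpha - phibar%:E)%E) \/
          ((penalized phi y1 y2 <= (phibar + eps)%:E)%E /\ rho = 0)].

Definition power_expansion (gamma kappa : R) : expansion_op :=
  fun alpha _ rho => alpha + rho `^ (kappa / 2) / gamma.

Definition subsolver phi (C : 'rV[R]_n -> R -> 'rV[R]_n) : Prop :=
  forall (u : 'rV[R]_n) (eps : R), edom phi u -> 0 < eps ->
    (phi (C u eps) <= minval phi + eps%:E)%E.

(* Big-step semantics of ITALEX-FT: ft_run ... s k s' holds iff the algorithm
   started from s = (alpha, x, z) terminates with output s' after exactly k
   calls to the approximation oracle. The output keeps the level alpha at which
   the last oracle call was made. *)
Inductive ft_run phi (orc : approx_op) (E : expansion_op) (eps phibar : R) :
    R * 'rV[R]_n * 'rV[R]_n -> nat -> R * 'rV[R]_n * 'rV[R]_n -> Prop :=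
| ft_stop alpha x z rho y1 y2 :
    orc x z alpha phibar (eps / 2) = (rho, y1, y2) ->
    (penalized phi y1 y2 <= (phibar + eps / 2)%:E)%E ->
    ft_run phi orc E eps phibar (alpha, x, z) 1 (alpha, y1, y2)
| ft_expand alpha x z rho y1 y2 k s :
    orc x z alpha phibar (eps / 2) = (rho, y1, y2) ->
    ~ (penalized phi y1 y2 <= (phibar + eps / 2)%:E)%E ->
    ft_run phi orc E eps phibar (E alpha phibar rho, y1, y2) k s ->
    ft_run phi orc E eps phibar (alpha, x, z) k.+1 s.

(* tol eps1 r is the tolerance of iteration r >= 1: it starts at eps1 and is
   halved after each iteration. *)
Definition tol (eps1 : R) (r : nat) : R := eps1 / 2 ^+ r.-1.

(* ct_run ... u0 s0 r u s N: the first r iterations of ITALEX-CT, started from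
   u0 and s0 = (alpha_0, x^0, z^0), terminate; they produce u^r and
   s = (alpha_r, x^r, z^r), with N calls to the approximation oracle in total. *)
Inductive ct_run phi (orc : approx_op) (E : expansion_op)
    (C : 'rV[R]_n -> R -> 'rV[R]_n) (eps1 : R)
    (u0 : 'rV[R]_n) (s0 : R * 'rV[R]_n * 'rV[R]_n) :
    nat -> 'rV[R]_n -> R * 'rV[R]_n * 'rV[R]_n -> nat -> Prop :=
| ct_init : ct_run phi orc E C eps1 u0 s0 0 u0 s0 0
| ct_solve r u alpha x z N phibar k s :
    ct_run phi orc E C eps1 u0 s0 r u (alpha, x, z) N ->
    phi (C u (tol eps1 r.+1 / 2)) = phibar%:E ->
    ((phibar + tol eps1 r.+1 / 2)%:E < penalized phi x z)%E ->
    ft_run phi orc E (tol eps1 r.+1) phibar (alpha, x, z) k s ->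
    ct_run phi orc E C eps1 u0 s0 r.+1 (C u (tol eps1 r.+1 / 2)) s (N + k)
| ct_skip r u alpha x z N phibar :
    ct_run phi orc E C eps1 u0 s0 r u (alpha, x, z) N ->
    phi (C u (tol eps1 r.+1 / 2)) = phibar%:E ->
    ~ ((phibar + tol eps1 r.+1 / 2)%:E < penalized phi x z)%E ->
    ct_run phi orc E C eps1 u0 s0 r.+1 (C u (tol eps1 r.+1 / 2)) (alpha, x, z) N.

End Algorithms.

(* Main.v *)
(* Every expansion keeps the level alpha below omega^*: for x in X^*, the
   oracle bound rho <= h(alpha) - phibar gives sqrt(rho) <= dist(x, Lev(alpha)),
   and the error bound turns rho^(kappa/2) / gamma into at most
   omega(x) - alpha. In an outer iteration of tolerance e, each expansion has
   rho >= e / 4 and so raises alpha by at least (e/4)^(kappa/2) / gamma. As the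
   tolerances decrease, the final one bounds the number of expansions over the
   whole run, and each outer iteration makes at most one oracle call that does not
   expand. For the last estimate, z^R and x^R lie in W^0 by the error bound at
   level alpha_0, and a finite convex function is Lipschitz on bounded sets. *)
Require Import Defs.
From HB Require Import structures.
From mathcomp Require Import all_boot all_order all_algebra.
From mathcomp Require Import all_classical all_reals all_analysis.
From mathcomp Require Import ring lra.
Import Order.TTheory GRing.Theory Num.Theory.
Import numFieldNormedType.Exports.
Local Open Scope classical_set_scope.
Local Open Scope ring_scope.

(** * The Euclidean norm, its comparison with the max norm, and distances to sets *)

Section EuclideanNorm.
Context {R : realType} {n : nat}.
Implicit Types (x y z : 'rV[R]_n) (A : set 'rV[R]_n).

Lemma enorm_ge0 x : 0 <= enorm x.
Proof. exact: sqrtr_ge0. Qed.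

Lemma sqr_enorm x : enorm x ^+ 2 = \sum_i x ord0 i ^+ 2.
Proof. by rewrite sqr_sqrtr// sumr_ge0// => i _; rewrite sqr_ge0. Qed.

Lemma enormZ (t : R) x : enorm (t *: x) = `|t| * enorm x.
Proof.
apply/eqP; rewrite -(@eqrXn2 _ 2) ?mulr_ge0 ?enorm_ge0//; apply/eqP.
rewrite exprMn !sqr_enorm real_normK ?num_real// mulr_sumr.
by apply: eq_bigr => i _; rewrite mxE exprMn.
Qed.

Lemma enormN x : enorm (- x) = enorm x.
Proof. by rewrite -scaleN1r enormZ normrN1 mul1r. Qed.

Lemma enormB x y : enorm (x - y) = enorm (y - x).
Proof. by rewrite -enormN opprB. Qed.

Lemma norm_coord_le_enorm x i : `|x ord0 i| <= enorm x.
Proof.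
rewrite -(@ler_pXn2r _ 2) ?nnegrE ?enorm_ge0// sqr_enorm real_normK ?num_real//.
by rewrite (bigD1 i)//= lerDl sumr_ge0// => j _; rewrite sqr_ge0.
Qed.

Lemma norm_coord_le_norm x i : `|x ord0 i| <= `|x|.
Proof.
rewrite [leRHS]/Num.Def.normr /= mx_normrE.
exact: (le_bigmax _ (fun ij : 'I_1 * 'I_n => `|x ij.1 ij.2|) (ord0, i)).
Qed.

Lemma norm_le_enorm x : `|x| <= enorm x.
Proof.
rewrite [leLHS]/Num.Def.normr /= mx_normrE.
apply/bigmax_leP; split; first exact: enorm_ge0.
by move=> [j i] _ /=; rewrite ord1; exact: norm_coord_le_enorm.
Qed.

(** The sharp factor is the square root of [n]; [n] itself, from [n <= n ^ 2], is enough to pass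
    from max-norm balls to Euclidean distances. *)
Lemma enorm_le_norm x : enorm x <= n%:R * `|x|.
Proof.
rewrite -(@ler_pXn2r _ 2) ?nnegrE ?enorm_ge0 ?mulr_ge0// sqr_enorm exprMn.
have h : \sum_i x ord0 i ^+ 2 <= \sum_(i < n) `|x| ^+ 2.
  apply: ler_sum => i _; rewrite -real_normK ?num_real//.
  by rewrite ler_pXn2r ?nnegrE// norm_coord_le_norm.
apply: (le_trans h).
rewrite sumr_const card_ord -[leLHS]mulr_natl; apply: ler_wpM2r; first exact: sqr_ge0.
by rewrite -natrX ler_nat; case: (n) => // m; rewrite expnS leq_pmulr// expn1.
Qed.

(** For nonzero [x] and [y], the sum of the squares of [x_i |y| - y_i |x|] expands to [2 |x| |y|]
    times the difference of the two sides. *)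
Lemma cauchy_schwarz x y :
  \sum_i x ord0 i * y ord0 i <= enorm x * enorm y.
Proof.
have [x0|x0] := eqVneq (enorm x) 0.
  rewrite x0 mul0r big1// => i _.
  have := norm_coord_le_enorm x i; rewrite x0 normr_le0 => /eqP->.
  by rewrite mul0r.
have [y0|y0] := eqVneq (enorm y) 0.
  rewrite y0 mulr0 big1// => i _.
  have := norm_coord_le_enorm y i; rewrite y0 normr_le0 => /eqP->.
  by rewrite mulr0.
have xgt : 0 < enorm x by rewrite lt_def x0 enorm_ge0.
have ygt : 0 < enorm y by rewrite lt_def y0 enorm_ge0.
have : 0 <= \sum_i (x ord0 i * enorm y - y ord0 i * enorm x) ^+ 2.
  by apply: sumr_ge0 => i _; exact: sqr_ge0.
have -> : \sum_i (x ord0 i * enorm y - y ord0 i * enorm x) ^+ 2 =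
  2 * (enorm x * enorm y) *
    (enorm x * enorm y - \sum_i x ord0 i * y ord0 i).
  rewrite (eq_bigr (fun i => enorm y ^+ 2 * x ord0 i ^+ 2
     + enorm x ^+ 2 * y ord0 i ^+ 2
     - 2 * enorm x * enorm y * (x ord0 i * y ord0 i))); last first.
    by move=> i _; ring.
  rewrite sumrB big_split/= -!mulr_sumr -!sqr_enorm.
  ring.
by rewrite pmulr_rge0 ?subr_ge0// !mulr_gt0.
Qed.

Lemma ler_enormD x y : enorm (x + y) <= enorm x + enorm y.
Proof.
rewrite -(@ler_pXn2r _ 2) ?nnegrE ?addr_ge0 ?enorm_ge0// sqr_enorm.
rewrite (eq_bigr (fun i => x ord0 i ^+ 2 + y ord0 i ^+ 2
   + 2 * (x ord0 i * y ord0 i))); last by move=> i _; rewrite mxE; ring.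
rewrite !big_split/= -mulr_sumr -!sqr_enorm.
have := cauchy_schwarz x y; nra.
Qed.

Lemma ler_enormB z x y : enorm (x - y) <= enorm (x - z) + enorm (z - y).
Proof. by rewrite -[in leLHS](subrKA z) ler_enormD. Qed.

Let lbound_enorm x A : lbound [set enorm (x - y) | y in A] 0.
Proof. by move=> _ [y _ <-]; exact: enorm_ge0. Qed.

Lemma edistance_le x y A : A y -> edistance x A <= enorm (x - y).
Proof.
by move=> Ay; apply: ge_inf; [exists 0; exact: lbound_enorm|exists y].
Qed.

Lemma edistance_ge x A c : A !=set0 ->
  (forall y, A y -> c <= enorm (x - y)) -> c <= edistance x A.
Proof.
move=> [y Ay] h; apply: lb_le_inf; first by exists (enorm (x - y)), y.
by move=> _ [z Az <-]; exact: h.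
Qed.

Lemma edistance_ge0 x A : A !=set0 -> 0 <= edistance x A.
Proof. by move=> A0; apply: edistance_ge => // y _; exact: enorm_ge0. Qed.

Lemma edistance_triangle x y A : A !=set0 ->
  edistance x A <= enorm (x - y) + edistance y A.
Proof.
move=> A0; rewrite addrC -lerBlDr; apply: edistance_ge => // z Az.
by rewrite lerBlDr addrC (le_trans (edistance_le x z A Az))// ler_enormB.
Qed.

Lemma edistance_lt x A c : A !=set0 -> edistance x A < c ->
  exists2 y, A y & enorm (x - y) < c.
Proof.
move=> A0 dc; apply: contrapT => nex; move: dc; apply/negP; rewrite -leNgt.
apply: edistance_ge => // y Ay; rewrite leNgt; apply/negP => h.
by apply: nex; exists y.
Qed.

(** Each point lies within [r + 1] of some point of the bounded set [A], which gives boundedness;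
    closedness holds because the distance to [A] is 1-Lipschitz. *)
Lemma compact_edistance_le A r : A !=set0 -> compact A ->
  compact [set x | edistance x A <= r].
Proof.
move=> A0 cA; apply: bounded_closed_compact.
  have [M [Mreal AM]] := compact_bounded cA.
  exists (M + 1 + (r + 1)); split; first exact: num_real.
  move=> N NM x /= xr.
  have [|y Ay xy] := edistance_lt x A (r + 1) A0.
    by rewrite (le_lt_trans xr)// ltrDl.
  have yM : `|y| <= M + 1 by apply: AM => //; rewrite ltrDl.
  have := ler_normD (x - y) y; rewrite subrK.
  have := norm_le_enorm (x - y); lra.
move=> x /= clx; apply/ler_addgt0Pr => e e0.
(* A max-norm ball of this radius has Euclidean radius at most [e]; the added 1 keeps the divisor
   positive when [n = 0]. *)
have d0 : 0 < e / (n%:R + 1) by rewrite divr_gt0// ltr_wpDl.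
have [y [/= yr]] := clx _ (nbhsx_ballx x _ d0).
rewrite -ball_normE/= ltr_pdivlMr ?ltr_wpDl// => xy.
have := edistance_triangle x y A A0; have := enorm_le_norm (x - y).
have := normr_ge0 (x - y); nra.
Qed.

End EuclideanNorm.

(** * Local boundedness and Lipschitz continuity of finite convex functions *)

Section ConvexLipschitz.
Context {R : realType} {n : nat}.
Variable w : 'rV[R]_n -> R.
Hypothesis w_convex : convex_function [set: 'rV[R]_n] w.
Implicit Types (x y : 'rV[R]_n) (A : set 'rV[R]_n).

Lemma convex_functionE x y (t : R) : 0 <= t -> t <= 1 ->
  w (t *: x + (1 - t) *: y) <= t * w x + (1 - t) * w y.
Proof.
move=> t0 t1; have ti : Itv.spec (Itv.num_sem (R:=R)) (Itv.Real `[0%Z, 1%Z]) t.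
  by rewrite /Itv.spec/= /Itv.num_sem/= num_real in_itv/= t0 t1.
exact: (w_convex (Itv.mk ti) x y (mem_setT x) (mem_setT y)).
Qed.

(* Induction on the number of nonzero coordinates: halving a point splits off
   its last coordinate, at the cost of doubling the box. *)
Lemma convex_bounded_above_box (k : nat) (M : R) : 0 <= M ->
  exists B, forall x, (forall i, `|x ord0 i| <= M) ->
    (forall i : 'I_n, (k <= i)%N -> x ord0 i = 0) -> w x <= B.
Proof.
elim: k M => [|k IH] M M0.
  exists (w 0) => x _ x0; suff -> : x = 0 by [].
  by apply/rowP => i; rewrite mxE x0.
have [B hB] := IH (2 * M) (mulr_ge0 (ler0n _ 2) M0).
have [kn|nk] := ltnP k n; last first.
  exists B => x xM x0; apply: hB => [i|i ki].
    by have := xM i; have := normr_ge0 (x ord0 i); lra.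
  by have := ltn_ord i; rewrite ltnNge (leq_trans nk ki).
pose j := Ordinal kn; pose e : 'rV[R]_n := delta_mx ord0 j.
exists (2^-1 * B + 2^-1 * Num.max (w ((2 * M) *: e)) (w ((- (2 * M)) *: e))).
move=> x xM x0.
(* [x] is the midpoint of [y], which is twice [x] with coordinate [j] removed, and of
   [(2 * c) *: e]. The induction hypothesis on the doubled box covers [y]; the other point lies on
   the segment between the two multiples of [e] in the bound. *)
pose c := x ord0 j; pose y : 'rV[R]_n := 2 *: (x - c *: e).
have yE i : y ord0 i = if i == j then 0 else 2 * x ord0 i.
  rewrite !mxE eqxx/=; have [->|_] := eqVneq i j; first by rewrite mulr1 subrr mulr0.
  by rewrite mulr0 subr0.
have -> : x = 2^-1 *: y + (1 - 2^-1) *: ((2 * c) *: e).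
  rewrite /y !scalerA mulVf ?pnatr_eq0// scale1r.
  have -> : (1 - 2^-1) * (2 * c) = c by field.
  by rewrite subrK.
apply: (le_trans (convex_functionE _ _ _ _ _)); [lra|lra|].
have -> : 1 - 2^-1 = 2^-1 :> R by field.
apply: lerD; apply: ler_wpM2l; [lra| |lra|].
  apply: hB => [i|i ki]; rewrite yE; have [//|ij] := eqVneq i j.
  - by rewrite normr0 mulr_ge0.
  - by rewrite normrM ger0_norm// ler_wpM2l.
  - rewrite x0 ?mulr0// ltn_neqAle ki andbT.
    by apply: contra ij => /eqP ij; apply/eqP/val_inj.
(* The weight [t] below divides by [M]; if [M = 0] the segment is a single point. *)
have [M00|Mgt] := eqVneq M 0.
  have := xM j; rewrite M00 normr_le0 => /eqP c0.
  by rewrite /c c0 mulr0 oppr0 maxxx.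
have Mp : 0 < M by rewrite lt_def Mgt.
have := xM j; rewrite -/c ler_norml => /andP[cl cu].
pose t := (c + M) / (2 * M).
have t0 : 0 <= t by rewrite divr_ge0//; lra.
have t1 : t <= 1 by rewrite ler_pdivrMr; lra.
have -> : (2 * c) *: e = t *: ((2 * M) *: e) + (1 - t) *: ((- (2 * M)) *: e).
  rewrite !scalerA -scalerDl; congr (_ *: _).
  by rewrite /t; field.
apply: (le_trans (convex_functionE _ _ _ t0 t1)).
have h1 : w ((2 * M) *: e) <= Num.max (w ((2 * M) *: e)) (w (- (2 * M) *: e)).
  by rewrite le_max lexx.
have h2 : w (- (2 * M) *: e) <= Num.max (w ((2 * M) *: e)) (w (- (2 * M) *: e)).
  by rewrite le_max lexx orbT.
nra.
Qed.

(** The box lemma with all [n] coordinates gives the upper bound [B]. Since 0 is the midpoint of [x]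
    and [- x], convexity gives [w x >= 2 * w 0 - w (- x) >= 2 * w 0 - B]. *)
Lemma convex_bounded_norm (M : R) : exists2 B, 0 <= B &
  forall x, `|x| <= M -> `|w x| <= B.
Proof.
have [M0|M0] := leP 0 M; last first.
  by exists 0 => // x xM; have := normr_ge0 x; rewrite leNgt (le_lt_trans xM).
have [B hB] := convex_bounded_above_box n M M0.
have {}hB x : `|x| <= M -> w x <= B.
  move=> xM; apply: hB => [i|i]; last by rewrite leqNgt ltn_ord.
  exact: le_trans (norm_coord_le_norm x i) xM.
exists (`|B| + 2 * `|w 0|) => [|x xM]; first by rewrite addr_ge0// mulr_ge0.
have /hB Bx := xM; have := xM; rewrite -normrN => /hB BNx.
have h : w 0 <= 2^-1 * w x + (1 - 2^-1) * w (- x).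
  have := convex_functionE x (- x) 2^-1; rewrite scalerN -scalerBl.
  by rewrite (_ : 2^-1 - _ = 0) ?scale0r; [apply; lra|field].
have := ler_norm B; have := normr_ge0 (w 0).
have := ler_norm (- w 0); rewrite normrN ler_norml => ? ? ?.
apply/andP; split; lra.
Qed.

(** Prolong the segment from [x] to [y] beyond [y] by Euclidean length 1, to a point [z]. Convexity
    bounds the slope of [w] from [x] to [y] by its increase from [x] to [z], which local boundedness
    controls. *)
Lemma convex_lipschitz_bounded A : bounded_set A ->
  exists2 L, 0 <= L & forall x y, A x -> A y -> `|w x - w y| <= L * enorm (x - y).
Proof.
move=> [M [_ AM]].
have {}AM x : A x -> `|x| <= M + 1 by apply: AM; rewrite ltrDl.
(* [M + 1] bounds [A], and the prolonged point [z] may leave that ball by at most 1. *)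
have [B B0 hB] := convex_bounded_norm (M + 2).
exists (2 * B); first by rewrite mulr_ge0.
suff h x y : A x -> A y -> w y - w x <= 2 * B * enorm (x - y).
  by move=> x y Ax Ay; rewrite ler_norml lerNl opprB enormB !h// -enormB h.
move=> /AM Ax /AM Ay.
have [d0|d0] := eqVneq (enorm (x - y)) 0.
  have := norm_le_enorm (x - y); rewrite d0 normr_le0 subr_eq0 => /eqP ->.
  by rewrite subrr mulr0.
set d := enorm (x - y) in d0 *.
have dp : 0 < d by rewrite lt_def d0 enorm_ge0.
pose z := y + d^-1 *: (y - x).
have zM : `|z| <= M + 2.
  have : `|d^-1 *: (y - x)| <= 1.
    rewrite normrZ gtr0_norm ?invr_gt0// mulrC ler_pdivrMr// mul1r.
    by rewrite distrC norm_le_enorm.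
  have := ler_normD y (d^-1 *: (y - x)); rewrite -/z; lra.
have d1 : 1 + d != 0 by rewrite gt_eqF//; lra.
pose t := d / (1 + d).
have yE : y = t *: z + (1 - t) *: x.
  rewrite /z scalerDr scalerA.
  have -> : t * d^-1 = 1 - t by rewrite /t; field; rewrite d0 d1.
  by rewrite scalerBr -addrA subrK -scalerDl addrC subrK scale1r.
have t0 : 0 <= t by rewrite divr_ge0//; lra.
have td : t <= d.
  by rewrite ler_pdivrMr; [nra|lra].
have t1 : t <= 1 by rewrite ler_pdivrMr; lra.
have := convex_functionE z x t t0 t1; rewrite -yE => wy.
have /hB := zM; rewrite ler_norml => /andP[_ wz].
have /hB : `|x| <= M + 2 by lra.
rewrite ler_norml => /andP[wx _].
have : w y - w x <= t * (w z - w x) by lra.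
nra.
Qed.

Lemma lipschitz_const_fin_num A : bounded_set A ->
  (lipschitz_const w A \is a fin_num)%E.
Proof.
move=> /convex_lipschitz_bounded[L L0 hL].
rewrite ge0_fin_numE.
  apply: (@le_lt_trans _ _ L%:E); last exact: ltry.
  by apply: ereal_inf_lbound; exists L.
by apply/ereal_infP => _ [K [K0 _] <-]; rewrite lee_fin.
Qed.

(** Off the level set [w] exceeds [a]; on it, boundedness of the set yields [- B]. This is what
    makes the real infimum [omega_star] a genuine lower bound. *)
Lemma convex_compact_level_bounded_below (a : R) : compact (level w a) ->
  exists m, forall x, m <= w x.
Proof.
move=> /compact_bounded[M [_ AM]].
have [B _ hB] := convex_bounded_norm (M + 1).
exists (Num.min a (- B)) => x; rewrite ge_min.
have [//|xa] := leP a (w x); apply/orP; right.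
have /hB : `|x| <= M + 1 by apply: (AM (M + 1)); rewrite /level/= ?ltrDl// ltW.
by rewrite ler_norml => /andP[].
Qed.

End ConvexLipschitz.

(** The infimum is attained as a constant: for [x] and [y] distinct, the difference quotient is a
    lower bound of all Lipschitz constants on [A]. *)
Lemma lipschitz_constP (R : realType) (n : nat) (w : 'rV[R]_n -> R) A x y :
  (lipschitz_const w A \is a fin_num)%E -> A x -> A y ->
  `|w x - w y| <= fine (lipschitz_const w A) * enorm (x - y).
Proof.
move=> lfin Ax Ay; have [d0|d0] := eqVneq (enorm (x - y)) 0.
  have := norm_le_enorm (x - y); rewrite d0 normr_le0 subr_eq0 => /eqP ->.
  by rewrite subrr normr0 mulr0.
have dp : 0 < enorm (x - y) by rewrite lt_def d0 enorm_ge0.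
rewrite -ler_pdivrMr// -lee_fin fineK//.
apply/ereal_infP => _ [L [_ hL] <-].
by rewrite lee_fin ler_pdivrMr// hL.
Qed.

(** * The composite objective and its minimal value *)

Section Composite.
Context {R : realType} {n : nat}.
Variables (f : 'rV[R]_n -> R) (g : 'rV[R]_n -> \bar R).

Lemma edom_composite x : edom (composite f g) x = edom g x.
Proof.
by rewrite /edom /composite /=; case: (g x) => [r| |]; rewrite ?ltry.
Qed.

Lemma composite_neqNy x : g x != -oo%E -> composite f g x != -oo%E.
Proof. by rewrite /composite; case: (g x). Qed.

End Composite.

Lemma minval_argmin (R : realType) (n : nat) (phi : 'rV[R]_n -> \bar R) x :
  argmin phi x -> minval phi = phi x.
Proof.
move=> xmin; apply/eqP; rewrite eq_le ereal_inf_lbound /=; last by exists x.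
by apply/ereal_infP => _ [y _ <-]; exact: xmin.
Qed.

(** * Termination and oracle counts of the inner and outer loops *)

Section Italex.
Context {R : realType} {n : nat}.
Variables (w : 'rV[R]_n -> R) (g phi : 'rV[R]_n -> \bar R).
Variables (gamma kappa : R) (orc : @approx_op R n).
Variables (C : 'rV[R]_n -> R -> 'rV[R]_n).
Local Notation wstar := (omega_star w phi).
Local Notation E := (power_expansion gamma kappa).

Hypothesis edom_phi : forall x, edom g x -> edom phi x.
Hypothesis phi_neqNy : forall x, phi x != -oo%E.
Hypothesis argmin_neq0 : argmin phi !=set0.
Hypothesis minval_fin : (minval phi \is a fin_num)%E.
Hypothesis w_bounded_below : exists m, forall x, m <= w x.
Hypothesis gamma_gt0 : 0 < gamma.
Hypothesis kappa_gt0 : 0 < kappa.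
Hypothesis w_error_bound : error_bound w gamma kappa.
Hypothesis orcP : approximation_oracle w g phi orc.
Hypothesis subsolverP : subsolver phi C.

(** Supplies the condition on the level that both the oracle contract and the error bound
    require. *)
Lemma omega_low_le a z : level w a z -> (omega_low w <= a%:E)%E.
Proof.
move=> za; apply: (@le_trans _ _ (w z)%:E); last by rewrite lee_fin.
by apply: ereal_inf_lbound; exists z.
Qed.

Lemma le_omega_star a : (forall x, argmin phi x -> a <= w x) -> a <= wstar.
Proof.
move=> h; apply: lb_le_inf.
  by have [x xmin] := argmin_neq0; exists (w x), x.
by move=> _ [x xmin <-]; exact: h.
Qed.

Lemma omega_star_le x : argmin phi x -> wstar <= w x.
Proof.
move=> xmin; apply: ge_inf; last by exists x.
by have [m hm] := w_bounded_below; exists m => _ [y _ <-].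
Qed.

Lemma expansion_le_omega_star a z phibar rho :
  level w a z -> a <= wstar -> (minval phi <= phibar%:E)%E -> 0 <= rho ->
  (rho%:E <= hfun w phi a - phibar%:E)%E -> E a phibar rho <= wstar.
Proof.
move=> za aw phib rho0 rhoh; apply: le_omega_star => x xmin.
have wx : a <= w x by rewrite (le_trans aw)// omega_star_le.
have phix : phi x = (fine (minval phi))%:E.
  by rewrite fineK// (minval_argmin _ _ _ x).
(* For each [y] in the level set, the pair [(x, y)] is feasible for [hfun]. As [phi x] is minimal
   and at most [phibar], only the penalty remains, so [rho] is at most the squared distance from [x]
   to [y]. *)
have rhod : Num.sqrt rho <= edistance x (level w a).
  apply: edistance_ge; first by exists z.
  move=> y ya; rewrite -(@ler_pXn2r _ 2) ?nnegrE ?sqrtr_ge0 ?enorm_ge0//.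
  rewrite sqr_sqrtr//.
  have hle : (hfun w phi a <= penalized phi x y)%E.
    by apply: ereal_inf_lbound; exists (x, y).
  have : (rho%:E <= penalized phi x y - phibar%:E)%E.
    by apply: (le_trans rhoh); rewrite leeD2r.
  rewrite /penalized phix -!EFinD lee_fin.
  by have := phib; rewrite -(fineK minval_fin) lee_fin; lra.
have := w_error_bound x a (omega_low_le a z za).
rewrite max_l ?subr_ge0// => eb.
have rhok : rho `^ (kappa / 2) <= edistance x (level w a) `^ kappa.
  rewrite mulrC powRrM powR12_sqrt// ge0_ler_powR ?nnegrE ?sqrtr_ge0 ?(ltW kappa_gt0)//.
  by rewrite (le_trans (sqrtr_ge0 _) rhod).
by rewrite /power_expansion -lerBrDl ler_pdivrMr// [leRHS]mulrC (le_trans rhok).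
Qed.

(** The least increase of the level in one expansion. The divisor 4 arises because the inner loop
    passes [eps / 2] to the oracle, which guarantees half of its own tolerance. *)
Definition expansion_step (eps : R) : R := (eps / 4) `^ (kappa / 2) / gamma.

Lemma expansion_step_gt0 eps : 0 < eps -> 0 < expansion_step eps.
Proof. by move=> e0; rewrite divr_gt0// powR_gt0// divr_gt0. Qed.

Lemma le_expansion_step e1 e2 : 0 <= e1 -> e1 <= e2 ->
  expansion_step e1 <= expansion_step e2.
Proof.
move=> e10 e12; rewrite ler_pM2r ?invr_gt0// ge0_ler_powR ?nnegrE//.
- by rewrite divr_ge0// ltW.
- by rewrite divr_ge0.
- by rewrite divr_ge0// (le_trans e10).
- by rewrite ler_pM2r ?invr_gt0.
Qed.

(** Since [4 = 2 ^ 2], the factor 4 under the power [kappa / 2] becomes the [2 ^ kappa] of the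
    complexity bound. *)
Lemma expansion_step_inv eps : 0 < eps ->
  (expansion_step eps)^-1 = 2 `^ kappa * gamma / eps `^ (kappa / 2).
Proof.
move=> e0; rewrite /expansion_step.
have -> : (eps / 4) `^ (kappa / 2) = eps `^ (kappa / 2) / 2 `^ kappa.
  rewrite powRM ?(ltW e0) ?invr_ge0//; congr (_ * _).
  have -> : 4^-1 = (2 `^ 2)^-1 :> R by rewrite powR_mulrn//; congr (_^-1); ring.
  by rewrite -powRN -powRrM -powRN; congr (_ `^ _); field.
have := powR_gt0 (kappa / 2) e0; have := powR_gt0 kappa (ltr0Sn R 1).
move=> /lt0r_neq0 h1 /lt0r_neq0 h2; field.
by rewrite h1 h2 (lt0r_neq0 gamma_gt0).
Qed.

(** The invariant of both loops: the oracle's requirements on the current points, and a level not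
    above the optimal one. *)
Record admissible (a : R) (x z : 'rV[R]_n) : Prop := Admissible {
  admissible_dom : edom phi x;
  admissible_level : level w a z;
  admissible_le : a <= wstar }.

(** [m] is fuel: [m] more expansions would push the level past [wstar], which the invariant forbids.
    Of the [k.+1] calls, the last does not expand, so only [k] of them are charged to the increase
    of the level. *)
Lemma ft_run_exists eps phibar : 0 < eps -> (minval phi <= phibar%:E)%E ->
  forall m a x z, admissible a x z -> wstar < a + m%:R * expansion_step eps ->
  exists k a' x' z',
    [/\ ft_run phi orc E eps phibar (a, x, z) k.+1 (a', x', z'),
        a + k%:R * expansion_step eps <= a', admissible a' x' z' &
        (penalized phi x' z' <= (phibar + eps / 2)%:E)%E].
Proof.
move=> e0 phib; elim=> [|m IH] a x z [xdom za aw].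
  by rewrite mul0r addr0 ltNge aw.
move=> am; case Eo : (orc x z a phibar (eps / 2)) => [[rho y1] y2].
have e20 : 0 < eps / 2 by rewrite divr_gt0.
have [rho0 gy1 y2a alt] :=
  orcP x z a phibar (eps / 2) e20 phib (omega_low_le a z za) xdom za _ _ _ Eo.
(* The split is on the stopping test, which may succeed under either oracle alternative; its failure
   excludes the alternative [rho = 0] and leaves [rho >= eps / 4]. *)
have [stop|nstop] := pselect (penalized phi y1 y2 <= (phibar + eps / 2)%:E)%E.
  exists 0, a, y1, y2; split => //; first exact: ft_stop Eo stop.
    by rewrite mul0r addr0.
  by split => //; exact: edom_phi.
case: alt => [[rhoe rhoh]|[//]].
set a1 := E a phibar rho.
have a1w : a1 <= wstar by exact: (expansion_le_omega_star a z).
have a1s : a + expansion_step eps <= a1.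
  rewrite lerD2l ler_pM2r ?invr_gt0// ge0_ler_powR ?nnegrE//.
  - by rewrite divr_ge0// ltW.
  - by rewrite divr_ge0// ltW.
  - by rewrite (le_trans _ rhoe)//; lra.
have s0 := expansion_step_gt0 eps e0.
have adm1 : admissible a1 y1 y2.
  split => //; first exact: edom_phi.
  by rewrite /level/= (le_trans y2a)//; lra.
have am1 : wstar < a1 + m%:R * expansion_step eps.
  by apply: (lt_le_trans am); rewrite -natr1; lra.
have [k [a' [x' [z' [run ka adm pen]]]]] := IH a1 y1 y2 adm1 am1.
exists k.+1, a', x', z'; split => //; first exact: ft_expand Eo nstop run.
by rewrite (le_trans _ ka)// -natr1; lra.
Qed.

Lemma tol_gt0 (eps1 : R) r : 0 < eps1 -> 0 < tol eps1 r.
Proof. by move=> e0; rewrite divr_gt0// exprn_gt0. Qed.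

Lemma tolS_le (eps1 : R) r : 0 < eps1 -> tol eps1 r.+1 <= tol eps1 r.
Proof.
(* Iterations 0 and 1 share a tolerance, because [0.-1 = 0]. *)
move=> e0; case: r => [//|r]; rewrite /tol/= ler_pM2l// exprS invfM.
by rewrite ler_piMl ?invr_ge0 ?exprn_ge0// invf_le1//; lra.
Qed.

(** By induction on [r]. The increases of the level telescope to [a - a0], each counted at the
    current, smallest step; the summand [r] pays for one final call per iteration. The last clause
    needs [0 < r] because the starting point carries no accuracy guarantee. *)
Lemma ct_run_exists eps1 u0 a0 x0 z0 : 0 < eps1 -> edom phi u0 ->
  admissible a0 x0 z0 -> forall r, exists u a x z N,
    [/\ ct_run phi orc E C eps1 u0 (a0, x0, z0) r u (a, x, z) N,
        edom phi u, admissible a x z /\ a0 <= a,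
        N%:R <= (a - a0) / expansion_step (tol eps1 r) + r%:R &
        (0 < r)%N -> (penalized phi x z <= minval phi + (tol eps1 r)%:E)%E].
Proof.
move=> e0 udom adm0; elim=> [|r].
  exists u0, a0, x0, z0, 0; split => //; first exact: ct_init.
  by rewrite subrr mul0r addr0.
move=> [u [a [x [z [N [run ud [adm a0a] hN _]]]]]].
have t0 := tol_gt0 eps1 r.+1 e0.
have t20 : 0 < tol eps1 r.+1 / 2 by rewrite divr_gt0.
have s0 := expansion_step_gt0 _ t0.
have Cu := subsolverP u (tol eps1 r.+1 / 2) ud t20.
set v := C u (tol eps1 r.+1 / 2) in Cu.
have vfin : (phi v \is a fin_num)%E.
  rewrite fin_real// ltNye phi_neqNy (le_lt_trans Cu)//.
  by rewrite -(fineK minval_fin) -EFinD ltry.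
have vdom : edom phi v by rewrite /edom/= ltey_eq vfin.
pose phibar := fine (phi v).
have vE : phi v = phibar%:E by rewrite fineK.
have phib : (minval phi <= phibar%:E)%E.
  by rewrite -vE; apply: ereal_inf_lbound; exists v.
(* One half of the tolerance is spent on the error of [phibar], the other on the stopping or
   skipping test. *)
have bound : ((phibar + tol eps1 r.+1 / 2)%:E <=
    minval phi + (tol eps1 r.+1)%:E)%E.
  move: Cu; rewrite vE -(fineK minval_fin) -!EFinD !lee_fin; lra.
have mono : (a - a0) / expansion_step (tol eps1 r) <=
            (a - a0) / expansion_step (tol eps1 r.+1).
  rewrite ler_wpM2l ?subr_ge0// lef_pV2 ?posrE ?expansion_step_gt0 ?tol_gt0//.
  by rewrite le_expansion_step ?tolS_le// ltW.
have [solve|skip] :=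
  pselect ((phibar + tol eps1 r.+1 / 2)%:E < penalized phi x z)%E; last first.
  exists v, a, x, z, N; split => //.
  - exact: ct_skip run vE skip.
  - by rewrite -natr1; lra.
  - by move=> _; rewrite (le_trans _ bound)// leNgt; apply/negP.
(* One more than the number of whole steps between [a] and [wstar] is enough fuel. *)
pose m := Num.trunc ((wstar - a) / expansion_step (tol eps1 r.+1)).
have wm : wstar < a + m.+1%:R * expansion_step (tol eps1 r.+1).
  rewrite -ltrBlDl -ltr_pdivrMr//.
  exact: truncnS_gt.
have [k [a' [x' [z' [frun ka adm' pen]]]]] :=
  ft_run_exists _ phibar t0 phib m.+1 a x z adm wm.
have aa' : a <= a' by rewrite (le_trans _ ka)// lerDl mulr_ge0// ltW.
exists v, a', x', z', (N + k.+1)%N; split => //.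
- exact: ct_solve run vE solve frun.
- by split => //; exact: le_trans aa'.
- have -> : (a' - a0) / expansion_step (tol eps1 r.+1) =
    (a - a0) / expansion_step (tol eps1 r.+1)
    + (a' - a) / expansion_step (tol eps1 r.+1).
    by rewrite -mulrDl; congr (_ / _); ring.
  have : k%:R <= (a' - a) / expansion_step (tol eps1 r.+1).
    by rewrite ler_pdivlMr//; lra.
  by rewrite natrD -!natr1; lra.
- by move=> _; exact: le_trans pen bound.
Qed.

End Italex.

(** * The number of outer iterations and the final estimates *)

Lemma tol_le_of_log2_le (R : realType) (eps1 eps : R) m : 0 < eps1 -> 0 < eps ->
  ln (eps1 / eps) / ln 2 <= m%:R -> tol eps1 m.+1 <= eps.
Proof.
move=> e10 e0; have ln2 : 0 < ln (2 : R) by rewrite ln_gt0// ltr1n.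
rewrite ler_pdivrMr// mulr_natl -lnXn// ler_ln ?posrE ?divr_gt0 ?exprn_gt0//.
by rewrite ler_pdivrMr// /tol/= ler_pdivrMr ?exprn_gt0// mulrC.
Qed.

Theorem corollary1 (R : realType) (n : nat)
  (f : 'rV[R]_n -> R) (Lf : R) (g : 'rV[R]_n -> \bar R) (w : 'rV[R]_n -> R)
  (gamma kappa : R)
  (orc : @approx_op R n) (C : 'rV[R]_n -> R -> 'rV[R]_n)
  (eps1 alpha0 : R) (x0 z0 u0 : 'rV[R]_n) (eps wbar : R) :
  let phi := composite f g in
  let wstar := omega_star w phi in
  smooth_convex f Lf ->
  proper_function g -> closed_function g -> convex_efunction g ->
  argmin phi !=set0 ->
  convex_function [set: 'rV[R]_n] w ->
  (forall a : R, compact (level w a)) ->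
  0 < gamma -> 0 < kappa -> kappa <= 2 ->
  error_bound w gamma kappa ->
  approximation_oracle w g phi orc ->
  subsolver phi C ->
  0 < eps1 -> alpha0 <= wstar ->
  edom g x0 -> level w alpha0 z0 -> edom g u0 ->
  0 < eps -> wstar <= wbar ->
  let R0 := (gamma * (wbar - w z0)) `^ kappa^-1 + Num.sqrt eps in
  let W0 := [set x : 'rV[R]_n | edistance x (level w alpha0) <= R0] in
  [/\ compact W0,
      (lipschitz_const w W0 \is a fin_num)%E &
      exists (r N : nat) (u : 'rV[R]_n) (alpha : R) (x z : 'rV[R]_n),
        ct_run phi orc (power_expansion gamma kappa) C eps1 u0 (alpha0, x0, z0)
          r u (alpha, x, z) N /\
        [/\ (r%:Z <= Num.max (Num.ceil (ln (eps1 / eps) / ln 2) + 1) 1)%R,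
            N%:R <= 2 `^ kappa * gamma * (wstar - w z0)
                      / Num.min eps (tol eps1 r) `^ (kappa / 2) + r%:R,
            (phi x - minval phi <= eps%:E)%E,
            edistance x (level w wstar) <= Num.sqrt eps &
            w x - wstar <= fine (lipschitz_const w W0) * Num.sqrt eps]].
Proof.
move=> phi wstar _ [gNy [y gy]] _ _ argmin0 wcvx wcpt gamma0 kappa0 _ eb orcP
  CP eps10 a0w x0dom z0a u0dom eps0 wwbar R0 W0.
have lev0 : level w alpha0 !=set0 by exists z0.
have W0cpt : compact W0 by exact: compact_edistance_le.
have lipfin := lipschitz_const_fin_num w wcvx W0 (compact_bounded W0cpt).
split => //.
have edomE x : edom g x -> edom phi x by rewrite edom_composite.
have phiNy x : phi x != -oo%E by exact: composite_neqNy.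
have minfin : (minval phi \is a fin_num)%E.
  have [xs xmin] := argmin0; rewrite (minval_argmin _ _ _ xs)//.
  rewrite fin_real// ltNye phiNy/=.
  exact: (le_lt_trans (xmin y) (edomE y gy)).
have wbelow := convex_compact_level_bounded_below w wcvx 0 (wcpt 0).
have adm0 : admissible w phi alpha0 x0 z0 by split => //; exact: edomE.
(* Truncation at 0 covers [eps1 < eps], where the logarithm is negative; [m.+1] iterations are run,
   hence at least one. *)
pose c : int := Num.max (Num.ceil (ln (eps1 / eps) / ln 2)) 0.
pose m := `|c|%N.
have c0 : 0 <= c by rewrite le_max lexx orbT.
have mE : m%:Z = c by rewrite gez0_abs.
have mlog : ln (eps1 / eps) / ln 2 <= m%:R.
  apply: (le_trans (ceil_ge _)); rewrite -[m%:R]/(m%:Z%:~R) ler_int mE.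
  by rewrite le_max lexx.
have tole := tol_le_of_log2_le _ eps1 eps m eps10 eps0 mlog.
have tol0 := tol_gt0 eps1 m.+1 eps10.
have [u [a [x [z [N [run _ [[xdom za aw] a0a] hN pen]]]]]] :=
  ct_run_exists _ _ _ _ _ _ C edomE phiNy argmin0 minfin wbelow gamma0 kappa0
    eb orcP CP eps1 u0 alpha0 x0 z0 eps10 (edomE _ u0dom) adm0 m.+1.
have {}pen : (phi x + (enorm (x - z) ^+ 2)%:E <= minval phi + eps%:E)%E.
  by apply: (le_trans (pen isT)); rewrite leeD2l// lee_fin.
have minx : (minval phi <= phi x)%E by apply: ereal_inf_lbound; exists x.
have xfin : (phi x \is a fin_num)%E by rewrite fin_real// ltNye phiNy.
have [penR minxR] : fine (phi x) + enorm (x - z) ^+ 2 <= fine (minval phi) + eps /\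
    fine (minval phi) <= fine (phi x).
  by rewrite -!lee_fin !EFinD !fineK.
(* As [phi x] is at least the minimum, the whole penalty fits into [eps]. *)
have xz : enorm (x - z) <= Num.sqrt eps.
  rewrite -(@ler_pXn2r _ 2) ?nnegrE ?enorm_ge0 ?sqrtr_ge0// (sqr_sqrtr (ltW eps0)); lra.
have z0w : w z0 <= wstar by exact: le_trans a0w.
exists m.+1, N, u, a, x, z; split => //; split.
- by rewrite -addn1 PoszD mE /c addr_maxl add0r.
(* The minimum is the last tolerance, already at most [eps]; the level gain is at most
   [wstar - w z0] because [w z0 <= alpha0]. *)
- rewrite min_r//; apply: (le_trans hN); rewrite lerD2r.
  rewrite expansion_step_inv// mulrC mulrAC.
  rewrite ler_pM2r ?invr_gt0 ?powR_gt0// ler_pM2l ?mulr_gt0 ?powR_gt0//.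
  by apply: lerB.
- rewrite -(fineK xfin) -(fineK minfin) -EFinB lee_fin.
  by have := sqr_ge0 (enorm (x - z)); lra.
- by apply: le_trans xz; apply: edistance_le; exact: le_trans aw.
(* The error bound at level [alpha0], followed by a [kappa]-th root, gives the first summand of
   [R0]; moving from [z] to [x] adds the second. *)
- have zd : edistance z (level w alpha0) <= (gamma * (wbar - w z0)) `^ kappa^-1.
    have d0 := edistance_ge0 z (level w alpha0) lev0.
    have := eb z alpha0 (omega_low_le w alpha0 z0 z0a) => ebz.
    rewrite -[leLHS]powRr1// -(mulfV (lt0r_neq0 kappa0)) powRrM.
    apply: ge0_ler_powR; rewrite ?nnegrE ?invr_ge0 ?(ltW kappa0) ?powR_ge0//.
      by rewrite mulr_ge0 ?(ltW gamma0)// subr_ge0 (le_trans z0w).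
    apply: (le_trans ebz); rewrite ler_pM2l// ge_max subr_ge0 (le_trans z0w)// andbT.
    by apply: lerB => //; rewrite (le_trans za)// (le_trans aw).
  have zW : W0 z by rewrite /W0/= (le_trans zd)// lerDl sqrtr_ge0.
  have xW : W0 x.
    rewrite /W0/= (le_trans (edistance_triangle x z _ lev0))// addrC.
    exact: lerD.
  (* Because [w z <= wstar], the excess of [w x] is at most [w x - w z], to which the Lipschitz
     bound applies. *)
  have := lipschitz_constP _ _ w W0 x z lipfin xW zW.
  have L0 : 0 <= fine (lipschitz_const w W0).
    by apply: fine_ge0; apply/ereal_infP => _ [L [L0 _] <-]; rewrite lee_fin.
  have := ler_wpM2l L0 xz; have := ler_norm (w x - w z).
  have : w z <= wstar by exact: le_trans aw.
  lra.
Qed.
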